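(* Let $(X,d)$ be a finite metric space and let $h$ be a chaining functional of log-concave type with $|h'(1)|=1$ (left derivative). For any probability measure $\nu$ on $X$, $$\int_X\int_0^\infty h(\nu(B(x,r)))\,dr\,d\nu(x)\;\le\;2\min_{\mu}\int_X\int_0^\infty h(\mu(B(x,r)))\,dr\,d\nu(x)\;+\;\mathbf D(X)/e,$$ where the minimum is over all probability measures $\mu$ on $X$.
   Context: $B(x,r)=\{y\in X: d(x,y)\le r\}$ and $\mathbf D(X)=\max_{u,v\in X}d(u,v)$; $e$ is the base of the natural logarithm. Chaining functional: let $f:[0,\infty)\to[0,\infty)$ be a continuous, non-increasing probability density on $[0,\infty)$ and let $F(s)=\int_s^\infty f(t)\,dt$. The chaining functional induced by $f$ is $h(p)=F^{-1}(p)$ for $p\in(0,1]$ (so $h(1)=0$ and $h$ is strictly decreasing and convex). It is of log-concave type if $f$ is log-concave. The normalization $|h'(1)|=1$ is equivalent to $f(0)=1$. We read $h(0)=\lim_{p\to0^+}h(p)\in(0,\infty]$ and $0\cdot\infty=0$. *)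

(* Defs.v *)
From HB Require Import structures.
From mathcomp Require Import all_boot all_order all_algebra.
From mathcomp Require Import all_classical all_reals all_analysis.

Set Implicit Arguments.
Unset Strict Implicit.
Unset Printing Implicit Defensive.

Import Order.TTheory GRing.Theory Num.Theory.
Import numFieldNormedType.Exports.

Local Open Scope classical_set_scope.
Local Open Scope ring_scope.

(* [Pointed] is needed for the measurable structure below; it only excludes the
   empty space, on which there is no probability measure. *)
#[short(type="finMetricType")]
HB.structure Definition FinMetric (R : numDomainType) :=
  {X of Finite X & Metric R X & Pointed X}.

Section finite_metric_space.
Context {R : realType} {X : finMetricType R}.

(* Not the library's [closed_ball], which is the closure of the open ball. *)
Definition cball (x : X) (r : R) : set X := [set y | mdist x y <= r].

Definition diam : R :=
  \big[Num.max/0]_(u : X) \big[Num.max/0]_(v : X) mdist u v.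

End finite_metric_space.
Arguments diam {R} X.

(* Every subset of X is measurable. *)
Notation discrete X := (g_sigma_algebraType (@discrete_measurable X)).

Section chaining_functional.
Context {R : realType}.
Implicit Types f h : R -> R.

(* The values of f outside [0, +oo[ are irrelevant, here and below. *)
Definition chaining_density f : Prop :=
  [/\ {within `[0, +oo[, continuous f},
      {in `[0, +oo[ &, {homo f : s t / s <= t >-> t <= s}},
      {in `[0, +oo[, forall t, 0 <= f t} &
      (\int[lebesgue_measure]_(t in `[0%R, +oo[) (f t)%:E = 1)%E].

Definition tail f (s : R) : \bar R :=
  (\int[lebesgue_measure]_(t in `[s, +oo[) (f t)%:E)%E.

(* [tail f] is injective where it is positive, so this determines h on ]0, 1];
   the values of h elsewhere are irrelevant. *)
Definition induced_by f h : Prop :=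
  {in `]0, 1], forall p, 0 <= h p /\ tail f (h p) = p%:E}.

Definition log_concave f : Prop :=
  {in `[0, +oo[ &, forall x y, {in `]0, 1[, forall t,
    f x `^ t * f y `^ (1 - t) <= f (t * x + (1 - t) * y)}}.

Definition log_concave_chaining_functional h : Prop :=
  exists f, [/\ chaining_density f, log_concave f & induced_by f h].

Definition is_left_derivative h (x l : R) : Prop :=
  (h y - h x) / (y - x) @[y --> x^'-] --> l.

(* h extended by h(0) = lim_(q -> 0+) h(q), which may be +oo. *)
Definition extend0 h (p : R) : \bar R :=
  if p == 0 then lim ((h q)%:E @[q --> 0^'+]) else (h p)%:E.

Definition chaining_integral (X : finMetricType R) h
    (mu nu : probability (discrete X) R) : \bar R :=
  (\int[nu]_x \int[lebesgue_measure]_(r in `[0%R, +oo[)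
     extend0 h (fine (mu (cball x r))))%E.

End chaining_functional.

(* Main.v *)
Require Import Defs.
From mathcomp Require Import all_boot all_order all_algebra.
From mathcomp Require Import all_classical all_reals all_analysis.
From mathcomp Require Import measurable_realfun ring lra.

Set Implicit Arguments.
Unset Strict Implicit.
Unset Printing Implicit Defensive.

Import Order.TTheory GRing.Theory Num.Theory.
Import numFieldNormedType.Exports.

Local Open Scope classical_set_scope.
Local Open Scope ring_scope.

(** The functional [h] enters through a single estimate,
      [h p - h q <= ln (q / p)]  for  [0 < p <= q <= 1].
    It comes from the density [f] as follows. The normalization of the slope at
    1 gives [f 0 >= 1] (lemma [density0_ge1]). Log-concavity makes [f]
    submultiplicative, [f 0 * f (s + u) <= f s * f u], and integrating in [u]
    bounds the tail by the density, [tail f s <= f s] (lemma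
    [tail_le_density]). As [q - p] is the integral of [f] over
    [[h q, h p]], it is at least [(h p - h q) * f (h p) >= (h p - h q) * p]
    (lemma [functional_sub_le]). Iterating this along a geometric progression
    from [p] to [q] turns [(q - p) / p] into [ln (q / p)] (lemma
    [functional_ln]). Since [ln u <= u / e], it follows that
    [h p <= h q + (q / p) / e] for all [p] and [q], the case [q < p] holding by
    monotonicity.

    Let [mu] be any probability measure and fix a radius [r]. The last
    inequality with [p = nu (B(x, r))] and [q = mu (B(x, r/2))], averaged over
    [nu], bounds the average of [h (nu (B(x, r)))] by that of
    [h (mu (B(x, r/2)))] plus [1/e] times
      [\sum_x nu x * mu (B(x, r/2)) / nu (B(x, r))].
    This sum is at most 1 (lemma [sum_ball_ratio_le1]): for fixed [y] the points
    [x] of [B(y, r/2)] satisfy [B(y, r/2) \subset B(x, r)], so that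
      [\sum_(x in B(y, r/2)) nu x / nu (B(x, r)) <= 1].
    For [r >= D(X)] the ball is the whole space and there is nothing to add, as
    [h 1 = 0]. Integrating over [r], the radius [r/2] produces the factor 2 and
    the constant [1/e] over [[0, D(X)[] produces [D(X)/e] (theorem
    [self_chaining_le]).

    The minimum over [mu] is attained by compactness (theorem
    [exists_minimizer]). Balls around a point take finitely many values, so the
    double integral is a finite sum of nonnegative multiples of the values of
    [h] at the masses of these sets; extended by its limit at 0, [h] is
    continuous on [[0, 1]] with values in the extended reals, and the
    probability measures form a compact simplex. *)

(** * Affine changes of variable for the Lebesgue measure *)

Section affine.
Context {R : realType}.
Let mu := @lebesgue_measure R.
Variables (a b : R).
Hypothesis a0 : 0 < a.
Let phi (r : measurableTypeR R) : measurableTypeR R := a * r + b.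

Let measurable_phi : measurable_fun setT phi.
Proof.
apply: (@continuous_measurable_fun R) => x; apply: cvgD; last exact: cvg_cst.
by apply: cvgM; [exact: cvg_cst | exact: cvg_id].
Qed.

(* The canonical pushforward measure, named in order to supply the proof that
   [phi] is measurable. *)
Let nu : {measure set (measurableTypeR R) -> \bar R} :=
  mscale (NngNum (ltW a0))
    (measure_function_pushforward__canonical__measure_function_Measure
      mu measurable_phi).

(** Both sides are measures, so it suffices to compare them on the half-open
    intervals that generate the Borel sets. *)
Let lebesgue_measure_affine (A : set (measurableTypeR R)) : measurable A ->
  mu A = nu A.
Proof.
apply: (@lebesgue_measure_unique R nu).
move=> _ [[c d] _ <-] /=.
rewrite /nu /mscale /= /pushforward.
have -> : phi @^-1` `]c, d]%classic = `](c - b) / a, (d - b) / a]%classic.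
  apply/seteqP; split => x /=; rewrite /phi !in_itv /= ltr_pdivrMr//
    ler_pdivlMr// [x * a]mulrC; lra.
rewrite /mu !lebesgue_measure_itv /= !lte_fin ltr_pM2r ?invr_gt0// ltrD2r.
case: ifPn => _; last by rewrite mule0.
rewrite -!EFinB -EFinM; congr EFin; field; by rewrite gt_eqF.
Qed.

Lemma ge0_integral_affine (g : R -> \bar R) :
  measurable_fun `[b, +oo[ g -> (forall x, b <= x -> (0 <= g x)%E) ->
  (\int[mu]_(x in `[b, +oo[) g x =
   a%:E * \int[mu]_(r in `[0%R, +oo[) g (a * r + b)%R)%E.
Proof.
move=> mg g0.
rewrite (@eq_measure_integral _ _ _ _ nu); last first.
  by move=> A mA _; exact: lebesgue_measure_affine.
rewrite ge0_integral_mscale//; last first.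
  by move=> x /=; rewrite in_itv/= andbT; exact: g0.
rewrite ge0_integral_pushforward//; last first.
  by move=> x; rewrite inE/= in_itv/= andbT; exact: g0.
congr (_ * _)%E; congr (integral mu _ _).
by apply/seteqP; split => x /=; rewrite /phi !in_itv /= !andbT;
  rewrite -lerBlDr subrr pmulr_rge0.
Qed.

End affine.

Lemma measure_itvco (R : realType) (t s : R) : t <= s ->
  lebesgue_measure `[t, s[%classic = (s - t)%:E.
Proof.
rewrite lebesgue_measure_itv/= lte_fin.
by case: ltgtP => // -> _; rewrite subrr.
Qed.

(** * From the density to the functional *)

Section density.
Context {R : realType}.
Variables (f h : R -> R).
Hypothesis df : chaining_density f.
Hypothesis fh : induced_by f h.

Local Notation mu := (@lebesgue_measure R).

Let fnoninc (x y : R) : 0 <= x -> x <= y -> f y <= f x.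
Proof.
case: df => _ + _ _ x0 xy; apply=> //; rewrite in_itv/= andbT//.
exact: le_trans xy.
Qed.

Let fge0 (x : R) : 0 <= x -> 0 <= f x.
Proof. by case: df => _ _ + _ x0; apply; rewrite in_itv/= andbT. Qed.

Let measurable_density (s : R) (i : itv_bound R) : 0 <= s ->
  measurable_fun [set` Interval (BLeft s) i] (EFin \o f).
Proof.
move=> s0; apply/measurable_EFinP.
suff : measurable_fun (`[0, +oo[%classic : set R) f.
  apply: measurable_funS => // x /=; rewrite !itv_boundlr /= => /andP[+ _].
  by rewrite !bnd_simp andbT; exact: le_trans.
by apply: subspace_continuous_measurable_fun => //; case: df.
Qed.

Lemma tail0 : tail f 0 = 1%E.
Proof. by case: df. Qed.

Lemma tailD (t s : R) : 0 <= t -> t <= s ->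
  (tail f t = \int[mu]_(x in `[t, s[) (f x)%:E + tail f s)%E.
Proof.
move=> t0 ts.
have E : (`[t, +oo[ = `[t, s[ `|` `[s, +oo[ :> set R)%classic.
  apply/seteqP; split => x /=; rewrite !in_itv/= !andbT.
    by move=> ->; case: (ltP x s); [left|right].
  by case => [/andP[]//|]; exact: le_trans.
rewrite /tail E ge0_integral_setU//.
- by rewrite -E; exact: measurable_density.
- move=> x; rewrite -E /= in_itv/= andbT => tx.
  by rewrite lee_fin fge0// (le_trans t0).
- apply/disj_setPS => x /= [] /=; rewrite !in_itv/= !andbT => /andP[_ xs].
  by rewrite leNgt xs.
Qed.

Lemma density_integral_ge (t s : R) : 0 <= t -> t <= s ->
  (((s - t) * f s)%:E <= \int[mu]_(x in `[t, s[) (f x)%:E)%E.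
Proof.
move=> t0 ts.
have -> : ((s - t) * f s)%:E = (\int[mu]_(x in `[t, s[) (f s)%:E)%E.
  by rewrite integral_cst// [X in (_ * X)%E](measure_itvco ts) -EFinM mulrC.
apply: ge0_le_integral => //.
- by move=> x _; rewrite lee_fin fge0// (le_trans t0).
- exact: measurable_density.
- move=> x /=; rewrite in_itv/= => /andP[tx xs].
  by rewrite lee_fin fnoninc// ?(le_trans t0)// ltW.
Qed.

Lemma density_integral_le (t s : R) : 0 <= t -> t <= s ->
  (\int[mu]_(x in `[t, s[) (f x)%:E <= ((s - t) * f t)%:E)%E.
Proof.
move=> t0 ts.
have -> : ((s - t) * f t)%:E = (\int[mu]_(x in `[t, s[) (f t)%:E)%E.
  by rewrite integral_cst// [X in (_ * X)%E](measure_itvco ts) -EFinM mulrC.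
apply: ge0_le_integral => //.
- move=> x /=; rewrite in_itv/= => /andP[tx xs].
  by rewrite lee_fin fge0// (le_trans t0).
- exact: measurable_density.
- by move=> x /=; rewrite in_itv/= => /andP[tx xs]; rewrite lee_fin fnoninc.
Qed.

Let hge0 (p : R) : 0 < p <= 1 -> 0 <= h p.
Proof. by move=> p01; have [] := fh (x := p); rewrite ?in_itv. Qed.

Let tail_h (p : R) : 0 < p <= 1 -> tail f (h p) = p%:E.
Proof. by move=> p01; have [] := fh (x := p); rewrite ?in_itv. Qed.

(** The tail is nonincreasing, so [h p < h q] would give [q <= p]. *)
Lemma functional_noninc (p q : R) :
  0 < p -> p <= q -> q <= 1 -> h q <= h p.
Proof.
move=> p0 pq q1.
have p01 : 0 < p <= 1 by rewrite p0 (le_trans pq).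
have q01 : 0 < q <= 1 by rewrite q1 (lt_le_trans p0).
rewrite leNgt; apply/negP => hpq.
have := tailD (hge0 p01) (ltW hpq); rewrite !tail_h// => E.
have : (q%:E <= p%:E)%E.
  rewrite E leeDr// integral_ge0// => x /=; rewrite in_itv/= => /andP[px _].
  by rewrite lee_fin fge0// (le_trans _ px)// hge0.
rewrite lee_fin => qp; have {}qp : p = q by apply/le_anti; rewrite pq.
by rewrite qp ltxx in hpq.
Qed.

(** [q - p] is the integral of the nonincreasing [f] over [[h q, h p[]. *)
Lemma functional_density (p q : R) : 0 < p -> p <= q -> q <= 1 ->
  (h p - h q) * f (h p) <= q - p <= (h p - h q) * f (h q).
Proof.
move=> p0 pq q1.
have p01 : 0 < p <= 1 by rewrite p0 (le_trans pq).
have q01 : 0 < q <= 1 by rewrite q1 (lt_le_trans p0).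
have hqp := functional_noninc p0 pq q1.
have := tailD (hge0 q01) hqp; rewrite !tail_h// => /eqP.
rewrite -sube_eq ?fin_num_adde_defl// => /eqP; rewrite -EFinB => E.
by rewrite -!lee_fin E density_integral_ge ?density_integral_le ?hge0.
Qed.

(** If [h 1] were positive, [f] would have integral 0 on [[0, h 1[]; being
    nonincreasing it would then vanish from [h 1] on, leaving no mass at all. *)
Lemma functional1 : h 1 = 0.
Proof.
have i1 : 0 < (1 : R) <= 1 by rewrite ltr01 lexx.
have h10 := hge0 i1; have t1 := tail_h i1.
apply/eqP; rewrite eq_le h10 andbT leNgt; apply/negP => h1.
have := tailD (lexx 0) h10; rewrite tail0 t1 => /eqP.
rewrite -sube_eq ?fin_num_adde_defl// subee// => /eqP E.
have := density_integral_ge (lexx 0) h10; rewrite -E subr0 lee_fin.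
rewrite pmulr_rle0// => fh1.
suff : tail f (h 1) = 0%E by rewrite t1 => -[/eqP]; rewrite oner_eq0.
apply: integral0_eq => x /=; rewrite in_itv/= andbT => hx.
congr EFin; apply/eqP; rewrite eq_le fge0 ?(le_trans h10)// andbT.
by rewrite (le_trans _ fh1)// fnoninc.
Qed.

(** Since [1 - y <= h y * f 0], the difference quotients of [h] at 1 are at most
    [- 1 / f 0], hence so is their limit [l], which must then be -1. *)
Lemma density0_ge1 (l : R) :
  is_left_derivative h 1 l -> `|l| = 1 -> 1 <= f 0.
Proof.
move=> dl l1; suff : f 0 * l <= -1.
  move=> le; rewrite -[leRHS]mulr1 -l1 -(ger0_norm (fge0 (lexx 0))) -normrM.
  by rewrite ler_normr; apply/orP; right; lra.
have : f 0 * ((h y - h 1) / (y - 1)) @[y --> 1^'-] --> f 0 * l.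
  by apply: cvgM => //; exact: cvg_cst.
move/cvgr_to_le; apply; near=> y.
have y1 : y < 1 by near: y; exact: nbhs_left_lt.
have y0 : 0 < y by near: y; exact: nbhs_left_gt.
have /andP[_] := functional_density y0 (ltW y1) (lexx 1).
rewrite functional1 subr0 => le.
by rewrite mulrA ler_ndivrMr ?subr_lt0//; lra.
Unshelve. all: by end_near. Qed.

Hypothesis lcf : log_concave f.

(** Both [s] and [u] are convex combinations of 0 and [s + u], with exchanged
    coefficients; multiply the two instances of log-concavity. *)
Lemma log_concave_submul (s u : R) : 0 <= s -> 0 <= u ->
  f 0 * f (s + u) <= f s * f u.
Proof.
rewrite le_eqVlt => /predU1P[<- _|s0]; first by rewrite add0r.
rewrite le_eqVlt => /predU1P[<-|u0]; first by rewrite addr0 mulrC.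
have w0 : 0 < s + u by rewrite addr_gt0.
have dom (x : R) : 0 <= x -> x \in `[0, +oo[ by rewrite in_itv/= andbT.
have conv (x : R) : 0 < x -> x < s + u ->
    f (s + u) `^ (x / (s + u)) * f 0 `^ (1 - x / (s + u)) <= f x.
  move=> x0 xw.
  have := @lcf _ _ (dom (s + u) (ltW w0)) (dom 0 (lexx 0)) (x / (s + u)).
  rewrite in_itv/= divr_gt0// ltr_pdivrMr// mul1r xw => /(_ isT).
  by rewrite mulr0 addr0 divfK// gt_eqF.
have eu : u / (s + u) = 1 - s / (s + u) by field; rewrite gt_eqF.
have := ler_pM _ _ (conv s s0 _) (conv u u0 _).
rewrite eu !mulr_ge0 ?powR_ge0// ltrDl ltrDr s0 u0 => /(_ isT isT isT isT).
rewrite subKr mulrACA -!powRD ?subrK ?[_ + (1 - _)]addrC ?subrK ?oner_eq0//.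
by rewrite !powRr1 ?fge0 1?mulrC// ltW.
Qed.

(** Integrate the submultiplicativity of [f] over [u >= 0], using that [f] has
    total mass 1. *)
Lemma tail_le_density (s : R) : 0 <= s -> ((f 0)%:E * tail f s <= (f s)%:E)%E.
Proof.
move=> s0; rewrite /tail (@ge0_integral_affine _ 1 s)//; last 2 first.
- exact: measurable_density.
- by move=> x sx; rewrite lee_fin fge0// (le_trans s0).
have shift_ge0 (r : R) : 0 <= r -> 0 <= 1 * r + s by lra.
have mshift : measurable_fun (`[0, +oo[%classic : set R)
    (fun r : R => (f (1 * r + s))%:E).
  apply: (@measurable_comp _ _ _ _ _ _ (`[0, +oo[%classic : set R)
    (EFin \o f)) => //.
  - move=> _ [x /= + <-] /=; rewrite !in_itv/= !andbT; exact: shift_ge0.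
  - exact: measurable_density.
  - apply: measurable_funD => //; apply: measurable_funM => //.
rewrite mul1e -ge0_integralZl//=; last 2 first.
- move=> x /=; rewrite in_itv/= andbT => x0.
  by rewrite lee_fin fge0// shift_ge0.
- by rewrite lee_fin fge0.
rewrite -[leRHS]mule1 -tail0 /tail -ge0_integralZl//; last 3 first.
- exact: measurable_density.
- by move=> x /=; rewrite in_itv/= andbT => x0; rewrite lee_fin fge0.
- by rewrite lee_fin fge0.
apply: ge0_le_integral => //.
- move=> x /=; rewrite in_itv/= andbT => x0.
  by rewrite mule_ge0// lee_fin fge0// shift_ge0.
- by apply: measurable_funeM.
- by apply: measurable_funeM; exact: measurable_density.
- move=> x /=; rewrite in_itv/= andbT => x0.
  by rewrite -!EFinM lee_fin mul1r addrC log_concave_submul.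
Qed.

(** An integrated form of [- h' p = 1 / f (h p) <= 1 / p]. *)
Lemma functional_sub_le (l p q : R) : is_left_derivative h 1 l -> `|l| = 1 ->
  0 < p -> p <= q -> q <= 1 -> p * (h p - h q) <= q - p.
Proof.
move=> dl l1 p0 pq q1.
have p01 : 0 < p <= 1 by rewrite p0 (le_trans pq).
have /andP[le _] := functional_density p0 pq q1.
apply: le_trans le; rewrite mulrC ler_wpM2l ?subr_ge0 ?functional_noninc//.
have := tail_le_density (hge0 p01); rewrite tail_h// -EFinM lee_fin.
by apply: le_trans; rewrite ler_peMl ?(ltW p0)// (density0_ge1 dl).
Qed.

End density.

(** * Normalized functionals *)

Section normalized.
Context {R : realType}.

(** Composing with this projection onto [[0, 1]] makes [extend0 h] continuous on
    the whole line, so that no restricted topology is needed later. *)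
Definition clamp (p : R) : R := Num.max 0 (Num.min 1 p).

Lemma clamp_id (p : R) : 0 <= p -> p <= 1 -> clamp p = p.
Proof. by move=> p0 p1; rewrite /clamp min_r// max_r. Qed.

(** The last clause is the trace left on [h] by log-concavity and the
    normalization at 1: an integrated form of [- h' p <= 1 / p]. *)
Definition normalized_functional (h : R -> R) : Prop :=
  [/\ h 1 = 0,
      forall p q : R, 0 < p -> p <= q -> q <= 1 -> h q <= h p &
      forall p q : R, 0 < p -> p <= q -> q <= 1 -> p * (h p - h q) <= q - p].

Variable h : R -> R.
Hypothesis nh : normalized_functional h.

Let hni (p q : R) : 0 < p -> p <= q -> q <= 1 -> h q <= h p.
Proof. by case: nh => _ + _; apply. Qed.

Let hlip (p q : R) : 0 < p -> p <= q -> q <= 1 -> p * (h p - h q) <= q - p.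
Proof. by case: nh => _ _; apply. Qed.

Let hge0 (p : R) : 0 < p -> p <= 1 -> 0 <= h p.
Proof. by case: nh => <- + _ p0 p1; apply. Qed.

(** Each step of ratio [expR x] costs at most [expR x - 1]. *)
Let h_geometric (n : nat) (p x : R) : 0 < p -> 0 <= x ->
  p * expR (n%:R * x) <= 1 ->
  h p - h (p * expR (n%:R * x)) <= n%:R * (expR x - 1).
Proof.
move=> p0 x0; elim: n => [|n IH]; first by rewrite !mul0r expR0 mulr1 subrr.
set q := p * expR (n%:R * x).
have -> : p * expR (n.+1%:R * x) = q * expR x.
  by rewrite -natr1 mulrDl mul1r expRD mulrA.
have q0 : 0 < q by rewrite mulr_gt0 ?expR_gt0.
have qq : q <= q * expR x by rewrite ler_pMr// -expR0 ler_expR.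
move=> q1.
have := IH (le_trans qq q1); have := hlip q0 qq q1.
have -> : q * expR x - q = q * (expR x - 1) by ring.
by rewrite ler_pM2l// -natr1 mulrDl mul1r; lra.
Qed.

(** With [n] steps of ratio [expR (a / n)], where [a = ln (q / p)], the total
    cost [n * (expR (a / n) - 1)] is at most [a / (1 - a / n)], which tends to
    [a] as [n] grows. *)
Lemma functional_ln (p q : R) : 0 < p -> p <= q -> q <= 1 ->
  h p - h q <= ln (q / p).
Proof.
move=> p0 pq q1; have q0 : 0 < q by exact: lt_le_trans pq.
set a := ln (q / p); set d := h p - h q.
have a0 : 0 <= a by rewrite ln_ge0// ler_pdivlMr// mul1r.
have d0 : 0 <= d by rewrite subr_ge0 hni.
have qE : q = p * expR a by rewrite lnK ?posrE ?divr_gt0// mulrC divfK ?gt_eqF.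
have step (n : nat) : a < n.+1%:R -> (n.+1%:R - a) * d <= a * n.+1%:R.
  set m : R := n.+1%:R => am; have m0 : 0 < m by rewrite ltr0n.
  have ma : m * (a / m) = a by field; rewrite gt_eqF.
  have := h_geometric (n := n.+1) (x := a / m) p0.
  rewrite -/m ma -qE -/d divr_ge0// ?(ltW m0)// => /(_ isT q1) le.
  have ee : expR (a / m) * (1 - a / m) <= 1.
    have := expR_ge1Dx (- (a / m)); rewrite expRN => e1.
    rewrite -(ler_pM2l (x := (expR (a / m))^-1)) ?invr_gt0 ?expR_gt0//.
    by rewrite mulr1 mulrA mulVf ?gt_eqF ?expR_gt0// mul1r.
  have mae : 0 < m - a by rewrite subr_gt0.
  apply: le_trans (ler_wpM2l (ltW mae) le) _.
  have -> : (m - a) * (m * (expR (a / m) - 1)) =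
      m * m * (expR (a / m) * (1 - a / m)) - m * m + a * m.
    by field; rewrite gt_eqF.
  rewrite -[leRHS]add0r lerD2r subr_le0.
  by rewrite ler_piMr// mulr_ge0 ?ltW.
(* Otherwise [n * (d - a) <= a * d] for arbitrarily large [n]. *)
rewrite leNgt; apply/negP => ad.
have da0 : 0 < d - a by rewrite subr_gt0.
have b0 : 0 <= a * d / (d - a) by rewrite divr_ge0 ?mulr_ge0// ltW.
have := archi_boundP (addr_ge0 a0 b0); set n := Num.bound _ => nb.
have := step n; rewrite -natr1.
have : a * d < n%:R * (d - a) by rewrite -ltr_pdivrMr//; lra.
by move=> ? /(_ ltac:(lra)); nra.
Qed.

(** [ln u <= u / e] is [1 + v <= expR v] at [v = ln u - 1]. *)
Lemma functional_div_e (p q : R) : 0 < p -> p <= 1 -> 0 < q -> q <= 1 ->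
  h p <= h q + q / p / expR 1.
Proof.
move=> p0 p1 q0 q1.
have u0 : 0 < q / p by exact: divr_gt0.
have [pq|qp] := leP p q; last first.
  by rewrite -[leLHS]addr0 lerD ?hni ?(ltW qp)// divr_ge0 ?expR_ge0// ltW.
rewrite -lerBlDl; apply: le_trans (functional_ln p0 pq q1) _.
have := expR_ge1Dx (ln (q / p) - 1).
by rewrite addrC subrK expRD expRN lnK.
Qed.

Let h_cvg0 : (h q)%:E @[q --> 0^'+] -->
  ereal_sup ((EFin \o h) @` [set` `]0, 1]]).
Proof.
apply: (@nonincreasing_at_right_cvge _ (EFin \o h) 0 (BRight 1)).
  by rewrite bnd_simp.
move=> p q; rewrite !in_itv/= => /andP[p0 _] /andP[_ q1] pq.
by rewrite lee_fin hni.
Qed.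

Lemma extend0_0 : extend0 h 0 = ereal_sup ((EFin \o h) @` [set` `]0, 1]]).
Proof. by rewrite /extend0 eqxx; apply/cvg_lim. Qed.

Lemma extend0_gt0 (p : R) : 0 < p -> extend0 h p = (h p)%:E.
Proof. by move=> p0; rewrite /extend0 gt_eqF. Qed.

Lemma extend0_1 : extend0 h 1 = 0%E.
Proof. by rewrite extend0_gt0//; case: nh => ->. Qed.

Lemma le_extend0_0 (p : R) : 0 < p -> p <= 1 -> ((h p)%:E <= extend0 h 0)%E.
Proof.
move=> p0 p1; rewrite extend0_0; apply: ereal_sup_ubound.
by exists p => //=; rewrite in_itv/= p0.
Qed.

Lemma extend0_ge0 (p : R) : 0 <= p -> p <= 1 -> (0 <= extend0 h p)%E.
Proof.
rewrite le_eqVlt => /predU1P[<- _|p0 p1].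
  by rewrite (le_trans _ (le_extend0_0 ltr01 (lexx 1)))// lee_fin hge0.
by rewrite extend0_gt0// lee_fin hge0.
Qed.

Lemma extend0_div_e (p q : R) : 0 < p -> p <= 1 -> 0 <= q -> q <= 1 ->
  (extend0 h p <= extend0 h q + (q / p / expR 1)%:E)%E.
Proof.
move=> p0 p1; rewrite le_eqVlt => /predU1P[<- _|q0 q1].
  by rewrite !mul0r adde0 extend0_gt0// le_extend0_0.
by rewrite !extend0_gt0// -EFinD lee_fin functional_div_e.
Qed.

(** The bound [p * (h p - h q) <= q - p] makes [h] Lipschitz away from 0, and at
    0 the extension of [h] is its limit by definition. *)
Lemma continuous_clamped :
  continuous (fun p : R => extend0 h (clamp p)).
Proof.
have clamp_neg (p : R) : p <= 0 -> clamp p = 0.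
  by move=> p0; rewrite /clamp min_r ?(le_trans p0)// max_l.
have clamp_pos (p : R) : 0 < p -> clamp p = Num.min 1 p.
  by move=> p0; rewrite /clamp max_r// le_min ler01 ltW.
move=> p; have [p0|p0|->] := ltgtP p 0.
- apply: cvg_near_cst; near=> x; rewrite !clamp_neg//; first exact: ltW.
  by apply: ltW; near: x; exact: lt_nbhsl.
- rewrite /continuous_at clamp_pos// extend0_gt0; last by rewrite lt_min ltr01.
  pose g (x : R) : R := h (Num.min 1 x).
  apply: (@cvg_trans _ ((EFin \o g) x @[x --> (p : R)])).
    apply: near_eq_cvg; near=> x.
    have x0 : 0 < x by near: x; exact: lt_nbhsr.
    by rewrite /= clamp_pos// extend0_gt0// lt_min ltr01.
  suff hc : g x @[x --> (p : R)] --> g p.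
    apply: (@cvg_EFin R R (nbhs (p : R)) _ (EFin \o g) (g p)) => //.
    exact: nearW.
  apply/cvgrPdist_le => /= e e0.
  (* Near [p] both arguments exceed [c], where [h] is [1 / c]-Lipschitz. *)
  pose c := Num.min 1 (p / 2).
  have c0 : 0 < c by rewrite lt_min ltr01 divr_gt0.
  have hdist (u v : R) : c <= u -> u <= v -> v <= 1 ->
      `|h u - h v| <= `|u - v| / c.
    move=> cu uv v1; have u0 : 0 < u by exact: lt_le_trans cu.
    rewrite ger0_norm ?subr_ge0 ?hni// distrC ger0_norm ?subr_ge0//.
    rewrite ler_pdivlMr//; apply: le_trans (hlip u0 uv v1).
    by rewrite mulrC ler_wpM2r// subr_ge0 hni.
  near=> x.
  have px : p / 2 <= x.
    by apply: ltW; near: x; apply: lt_nbhsr; rewrite ltr_pdivrMr//; lra.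
  have xe : `|p - x| <= c * e.
    by near: x; apply: cvgr_dist_le => //; exact: mulr_gt0.
  have cx : c <= Num.min 1 x by rewrite le_min ge_min lexx/= ge_min px orbT.
  have cp : c <= Num.min 1 p.
    by rewrite le_min ge_min lexx/= ge_min; apply/orP; right; lra.
  have {hdist} : `|h (Num.min 1 p) - h (Num.min 1 x)| <=
      `|Num.min 1 p - Num.min 1 x| / c.
    have [le|/ltW le] := leP (Num.min 1 p) (Num.min 1 x).
      by apply: hdist => //; rewrite ge_min lexx.
    by rewrite distrC [in leRHS]distrC; apply: hdist => //; rewrite ge_min lexx.
  move=> /le_trans; apply; rewrite ler_pdivrMr// mulrC.
  apply: le_trans xe.
  rewrite !minEle.
  case: (leP 1 p) => ?; case: (leP 1 x) => ?; rewrite ?subrr ?normr0//.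
  - by rewrite !ger0_norm; lra.
  - by rewrite !ler0_norm; lra.
- rewrite /continuous_at clamp_neg// => P nP.
  have Pr : \forall x \near (0 : R)^'+, P (h x)%:E.
    by apply: h_cvg0; rewrite -extend0_0.
  move: Pr; rewrite near_withinE => Pr.
  suff : \forall x \near (0 : R), P (extend0 h (clamp x)) by [].
  near=> x.
  have [x0|x0] := leP x 0.
    by rewrite clamp_neg//; exact: nbhs_singleton.
  have x1 : x < 1 by near: x; exact: lt_nbhsl.
  rewrite clamp_pos// min_r ?(ltW x1)// extend0_gt0//.
  by move: x0; near: x.
Unshelve. all: by end_near. Qed.

End normalized.

Lemma normalized_of_log_concave (R : realType) (h : R -> R) (l : R) :
  log_concave_chaining_functional h -> is_left_derivative h 1 l ->
  `|l| = 1 -> normalized_functional h.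
Proof.
move=> [f [df lcf fh]] dl l1; split.
- exact: functional1 df fh.
- by move=> p q; exact: functional_noninc df fh _ _.
- by move=> p q; exact: functional_sub_le df fh lcf _ _ _ dl l1.
Qed.

(** * Probability measures on a finite space *)

Section discrete_measure.
Context {R : realType} {X : finMetricType R}.
Implicit Types mu nu : probability (discrete X) R.

Lemma discrete_measurable_set (A : set (discrete X)) : measurable A.
Proof. exact: sub_sigma_algebra. Qed.

Definition weight mu (x : X) : R := fine (mu [set x]).

Lemma weight_ge0 mu x : 0 <= weight mu x.
Proof. by rewrite fine_ge0. Qed.

Lemma weightE mu x : mu [set x] = (weight mu x)%:E.
Proof.
by rewrite /weight fineK// fin_num_measure//; exact: discrete_measurable_set.
Qed.

Lemma ge0_integral_discrete mu (g : X -> \bar R) : (forall x, (0 <= g x)%E) ->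
  (\int[mu]_x g x = \sum_x (weight mu x)%:E * g x)%E.
Proof.
move=> g0.
have E : \big[setU/set0]_(x <- enum X) [set x] = [set: discrete X].
  apply/seteqP; split => // x _; rewrite -bigcup_seq; exists x => //=.
  by rewrite mem_enum.
rewrite -E (@ge0_integral_bigsetU _ _ _ mu X
  (fun x : X => [set x] : set (discrete X)))//.
- rewrite big_enum; apply: eq_bigr => x _.
  rewrite (eq_integral (fun=> g x)); last by move=> y; rewrite inE /= => ->.
  rewrite integral_cst; last exact: discrete_measurable_set.
  rewrite muleC; congr (_ * _)%E; exact: weightE.
- by move=> x; exact: discrete_measurable_set.
- exact: enum_uniq.
- by apply/trivIsetP => x y _ _ xy; apply/seteqP; split => // z [/= ->] /eqP;
    rewrite (negbTE xy).
- by move=> _ Y _; exact: discrete_measurable_set.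
Qed.

Lemma weight_sum mu (A : {set X}) :
  mu [set` A] = (\sum_(x in A) weight mu x)%:E.
Proof.
have := integral_indic mu measurableT (discrete_measurable_set [set` A]).
rewrite setIT => <-.
rewrite ge0_integral_discrete => [|x]; last by rewrite lee_fin.
rewrite -sumEFin [RHS]big_mkcond/=; apply: eq_bigr => x _.
by rewrite indicE mem_setE; case: ifPn; rewrite ?mule1 ?mule0.
Qed.

Lemma weight_sum1 mu : \sum_x weight mu x = 1.
Proof.
apply: EFin_inj; have <- := @probability_setT _ _ _ mu.
have -> : [set: discrete X] = [set` [set: X]%SET].
  by apply/seteqP; split => x //= _; rewrite inE.
by rewrite weight_sum; congr EFin; apply: eq_bigl => x; rewrite inE.
Qed.

Lemma weight_sum_itv mu (A : {set X}) : 0 <= \sum_(x in A) weight mu x <= 1.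
Proof.
rewrite sumr_ge0 => [|x _]; last exact: weight_ge0.
rewrite -(weight_sum1 mu) [leRHS](bigID (mem A))/= lerDl sumr_ge0// => x _.
exact: weight_ge0.
Qed.

(** The measure is a sum of scaled Dirac masses. Normalizing it leaves it
    unchanged and makes it a probability measure. *)
Lemma probability_of_weights (v : X -> R) : (forall x, 0 <= v x) ->
  \sum_x v x = 1 -> exists mu, weight mu = v.
Proof.
move=> v0 v1.
pose e (k : nat) : X := nth point (enum X) k.
pose c (k : nat) : {nonneg R} := NngNum (v0 (e k)).
pose m : {measure set (discrete X) -> \bar R} :=
  msum (fun k => mscale (c k) (dirac (e k : discrete X))) #|X|.
have mE A : m A = (\sum_x (v x)%:E * dirac (x : discrete X) A)%E.
  rewrite -[in RHS]big_enum (big_nth point) -cardE big_mkord.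
  by apply: eq_bigr.
have m1 : m setT = 1%E.
  rewrite mE -[RHS]/(1%:E) -v1 -sumEFin; apply: eq_bigr => x _.
  by rewrite diracT mule1.
pose P : probability (discrete X) R :=
  mnormalize m (dirac (point : discrete X) : probability (discrete X) R).
have PE A : P A = m A.
  by rewrite /P /= /mnormalize m1 onee_eq0/= invr1 mule1.
exists P; apply/funext => x; rewrite /weight PE.
rewrite mE (bigD1 x)//= diracE mem_set// mule1 big1 ?adde0// => y /eqP yx.
by rewrite diracE memNset ?mule0.
Qed.

End discrete_measure.

(** * Balls *)

Section balls.
Context {R : realType} {X : finMetricType R}.
Local Notation mu := (@lebesgue_measure R).

(** Balls as finite sets: their values range over a finite type, so functions of
    the radius that factor through them are step functions. *)
Definition fball (x : X) (r : R) : {set X} := [set y | mdist x y <= r]%SET.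

Lemma cball_fball (x : X) (r : R) : cball x r = [set` fball x r].
Proof. by apply/seteqP; split => y /=; rewrite /cball/= inE. Qed.

Lemma fball_center (x : X) (r : R) : 0 <= r -> x \in fball x r.
Proof. by move=> r0; rewrite inE mdistxx. Qed.

Lemma mdist_le_diam (x y : X) : mdist x y <= diam X.
Proof.
apply: le_trans (le_bigmax _ _ x); exact: (le_bigmax _ (fun v => mdist x v)).
Qed.

Lemma fball_diam (x : X) (r : R) : diam X <= r -> fball x r = [set: X]%SET.
Proof.
by move=> Dr; apply/setP => y; rewrite !inE (le_trans (mdist_le_diam x y)).
Qed.

Lemma diam_ge0 : 0 <= diam X.
Proof. exact: le_trans (mdist_ge0 point point) (mdist_le_diam _ _). Qed.

Lemma measurable_fball_eq (x : X) (A : {set X}) :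
  measurable [set r : R | fball x r = A].
Proof.
have -> : [set r : R | fball x r = A] = \bigcap_(y in [set: X])
    (if y \in A then `[mdist x y, +oo[ else `]-oo, mdist x y[)%classic.
  apply/seteqP; split => r /=.
    move=> <- y _; rewrite inE.
    by case: ifPn; rewrite /= in_itv/= ?andbT// -ltNge.
  move=> rA; apply/setP => y; rewrite inE; have := rA y I.
  by case: ifPn => _ /=; rewrite in_itv/= ?andbT// ltNge => /negbTE.
apply: fin_bigcap_measurable; first exact: finite_finset.
by move=> y _; case: ifPn.
Qed.

Lemma measurable_fball d (T : measurableType d) (G : {set X} -> T) (x : X)
  (D : set R) : measurable D -> measurable_fun D (fun r : R => G (fball x r)).
Proof.
move=> mD _ Y mY; apply: measurableI => //.
have -> : (fun r : R => G (fball x r)) @^-1` Y =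
    \bigcup_(A in [set A | Y (G A)]) [set r : R | fball x r = A].
  apply/seteqP; split => r /=; first by exists (fball x r).
  by case=> A /= YA ->.
apply: fin_bigcup_measurable; first exact: finite_finset.
by move=> A _; exact: measurable_fball_eq.
Qed.

Definition level (x : X) (A : {set X}) : set R :=
  `[0, +oo[%classic `&` [set r : R | fball x r = A].

(** The set of radii at which the ball is the whole space has infinite measure,
    read here as 0, which is harmless against a function vanishing there. *)
Definition level_length (x : X) (A : {set X}) : R := fine (mu (level x A)).

Lemma measurable_level (x : X) (A : {set X}) : measurable (level x A).
Proof. by apply: measurableI => //; exact: measurable_fball_eq. Qed.

Lemma level_lengthE (x : X) (A : {set X}) : A != [set: X]%SET ->
  mu (level x A) = (level_length x A)%:E.
Proof.
move=> AT; rewrite /level_length fineK// ge0_fin_numE//.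
have lev : level x A `<=` `[0, diam X[%classic.
  move=> r [/= + rA]; rewrite !in_itv/= andbT => ->/=.
  by rewrite ltNge; apply: contra AT => Dr; rewrite -rA fball_diam.
apply: le_lt_trans (le_measure mu _ _ lev) _; rewrite ?inE//.
  exact: measurable_level.
by rewrite [X in (X < _)%E](measure_itvco diam_ge0) ltry.
Qed.

Lemma level_length_ge0 (x : X) (A : {set X}) : 0 <= level_length x A.
Proof. by rewrite fine_ge0. Qed.

Lemma integral_fball (G : {set X} -> \bar R) (x : X) :
  (forall A, (0 <= G A)%E) -> G [set: X]%SET = 0%E ->
  (\int[mu]_(r in `[0%R, +oo[) G (fball x r) =
   \sum_A (level_length x A)%:E * G A)%E.
Proof.
move=> G0 GT.
have E : \big[setU/set0]_(A <- enum {set X}) level x A = `[0, +oo[%classic.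
  apply/seteqP; split => r; rewrite -bigcup_seq.
    by case=> A _ [].
  by move=> r0; exists (fball x r) => //=; rewrite mem_enum.
rewrite -E (@ge0_integral_bigsetU _ _ _ mu _ (level x)); last 5 first.
- exact: measurable_level.
- exact: enum_uniq.
- apply/trivIsetP => A B _ _ AB; apply/seteqP; split => // r [[_ rA] [_ rB]].
  by move: AB; rewrite -rA -rB eqxx.
- by rewrite E; exact: measurable_fball.
- by move=> r _.
rewrite big_enum; apply: eq_bigr => A _.
have -> : (\int[mu]_(r in level x A) G (fball x r) =
    \int[mu]_(r in level x A) G A)%E.
  by apply: eq_integral => r; rewrite inE => -[_ /= ->].
rewrite integral_cst; last exact: measurable_level.
have [->|AT] := eqVneq A [set: X]%SET; first by rewrite GT mul0e mule0.
by rewrite [X in (_ * X)%E](level_lengthE x AT) muleC.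
Qed.

Lemma integral_fball_half (G : {set X} -> \bar R) (x : X) :
  (forall A, (0 <= G A)%E) ->
  (\int[mu]_(r in `[0%R, +oo[) G (fball x (r / 2)) =
   2%:E * \int[mu]_(r in `[0%R, +oo[) G (fball x r))%E.
Proof.
move=> G0.
have h0 : 0 < 2^-1 :> R by rewrite invr_gt0.
rewrite [in RHS](ge0_integral_affine (b := 0) h0)//; last first.
  exact: measurable_fball.
rewrite muleA -EFinM divff ?pnatr_eq0// mul1e.
by apply: eq_integral => r _; rewrite addr0 mulrC.
Qed.

(** Exchange the sums. For fixed [y], a point [x] at distance at most [r / 2] of
    [y] has [fball y (r / 2) \subset fball x r], so replacing each denominator
    by the [n]-mass [M y] of [fball y (r / 2)] only increases the inner sum,
    which becomes [M y / M y]. Points of zero weight contribute 0, whatever the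
    denominator. *)
Lemma sum_ball_ratio_le1 (n m : X -> R) (r : R) :
  (forall x, 0 <= n x) -> (forall x, 0 <= m x) -> \sum_x m x = 1 ->
  \sum_x n x * ((\sum_(y in fball x (r / 2)) m y) /
                \sum_(y in fball x r) n y) <= 1.
Proof.
move=> n0 m0 m1; rewrite -[leRHS]m1.
pose N x := \sum_(y in fball x r) n y.
pose M y := \sum_(x in fball y (r / 2)) n x.
rewrite (_ : (\sum_x _) =
    \sum_y m y * \sum_(x in fball y (r / 2)) n x / N x); last first.
  under eq_bigr do rewrite mulrCA mulr_suml.
  rewrite (exchange_big_dep xpredT)//=; apply: eq_bigr => y _.
  rewrite mulr_sumr; apply: eq_big => [x|x _]; first by rewrite !inE metric_sym.
  by [].
apply: ler_sum => y _; rewrite ler_piMr//.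
have M0 : 0 <= M y by apply: sumr_ge0.
apply: (@le_trans _ _ (M y / M y)); last first.
  have [->|Mn0] := eqVneq (M y) 0; first by rewrite mul0r.
  by rewrite divff.
rewrite {1}/M mulr_suml; apply: ler_sum => x xy.
have := n0 x; rewrite le_eqVlt => /predU1P[<-|nx]; first by rewrite !mul0r.
rewrite ler_pM2l// lef_pV2 ?posrE.
- rewrite /M /N big_mkcond [leRHS]big_mkcond/=; apply: ler_sum => z _.
  move: xy; rewrite !inE => xy; case: ifPn => [yz|_]; last by case: ifP.
  case: ifPn => // /negP[]; apply: le_trans (metric_triangle _ y _) _.
  rewrite [r]splitr lerD// metric_sym//.
- apply: lt_le_trans nx _; rewrite /N (bigD1 x)/= ?lerDl ?sumr_ge0//.
  rewrite fball_center//; move: xy; rewrite inE => /(le_trans (mdist_ge0 _ _)).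
  by rewrite pmulr_lge0// invr_gt0.
- by apply: lt_le_trans nx _; rewrite /M (bigD1 x)//= lerDl sumr_ge0.
Qed.

End balls.

(** * Existence of a minimizer *)

Lemma contract_continuous (R : realType) : continuous (@contract R).
Proof.
move=> x; apply/cvgrPdist_lt => e e0.
by near=> y; near: y; exact: (nbhsx_ballx x e e0).
Unshelve. all: by end_near. Qed.

Section minimizer.
Context {R : realType} {X : finMetricType R}.
Variable h : R -> R.
Hypothesis nh : normalized_functional h.
Local Notation mu := (@lebesgue_measure R).

(** The chaining integral in terms of weights, [v] those of the measure inside
    [h] and [n] those of the outer one; it makes sense for arbitrary [v]. *)
Definition chaining_sum (n v : X -> R) : \bar R :=
  (\sum_x (n x)%:E * \sum_(A : {set X}) (level_length x A)%:E *
    extend0 h (clamp (\sum_(y in A) v y)))%E.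

Lemma fine_cball (m : probability (discrete X) R) (x : X) (r : R) :
  fine (m (cball x r)) = \sum_(y in fball x r) weight m y.
Proof. by rewrite cball_fball weight_sum. Qed.

Lemma extend0_weight_ge0 (m : probability (discrete X) R) (A : {set X}) :
  (0 <= extend0 h (\sum_(y in A) weight m y))%E.
Proof. by have /andP[? ?] := weight_sum_itv m A; exact: extend0_ge0. Qed.

Lemma extend0_weightT (m : probability (discrete X) R) :
  extend0 h (\sum_(y in [set: X]%SET) weight m y) = 0%E.
Proof.
have -> : \sum_(y in [set: X]%SET) weight m y = 1; last exact: extend0_1.
by rewrite -(weight_sum1 m); apply: eq_bigl => y; rewrite inE.
Qed.

Lemma chaining_integralE (m n : probability (discrete X) R) :
  (chaining_integral h m n =
   \sum_x (weight n x)%:E * \int[mu]_(r in `[0%R, +oo[)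
     extend0 h (\sum_(y in fball x r) weight m y))%E.
Proof.
rewrite /chaining_integral ge0_integral_discrete => [|x]; last first.
  by apply: integral_ge0 => r _; rewrite fine_cball; exact: extend0_weight_ge0.
apply: eq_bigr => x _; congr (_ * _)%E; apply: eq_integral => r _.
by rewrite fine_cball.
Qed.

Lemma chaining_integral_sum (m n : probability (discrete X) R) :
  chaining_integral h m n = chaining_sum (weight n) (weight m).
Proof.
rewrite chaining_integralE; apply: eq_bigr => x _; congr (_ * _)%E.
rewrite (integral_fball x (extend0_weight_ge0 m) (extend0_weightT m)).
apply: eq_bigr => A _; congr (_ * extend0 h _)%E.
by have /andP[? ?] := weight_sum_itv m A; rewrite clamp_id.
Qed.

Let T : topologicalType := prod_topology (fun _ : X => (R : topologicalType)).

Let coord_continuous (x : X) : continuous (fun v : T => v x : R).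
Proof. exact: proj_continuous. Qed.

Let sum_continuous (A : {set X}) : continuous (fun v : T => \sum_(x in A) v x).
Proof.
apply: continuous_big => [|x _]; first exact: add_continuous.
exact: coord_continuous.
Qed.

Let simplex : set T :=
  [set v | (forall x, 0 <= v x) /\ \sum_(x in [set: X]%SET) v x = 1].

Let simplex_compact : compact simplex.
Proof.
apply: (@subclosed_compact _ _ [set v : T | forall x, `[0, 1]%classic (v x)]).
- have -> : simplex = (\bigcap_(x in [set: X])
      ((fun v : T => v x : R) @^-1` [set t | 0 <= t])) `&`
      ((fun v : T => \sum_(x in [set: X]%SET) v x) @^-1` [set 1]).
    by apply/seteqP; split => v [v0 v1]; split => // x; move=> *; exact: v0.
  apply: closedI; last first.
    have /continuous_closedP := @sum_continuous [set: X]%SET; apply.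
    exact: closed_eq.
  apply: closed_bigI => x _.
  have /continuous_closedP := @coord_continuous x; apply.
  exact: closed_ge.
- have := @tychonoff X (fun=> R : topologicalType) (fun=> `[0, 1]%classic).
  by apply => x; exact: segment_compact.
- move=> v [v0 v1] x /=; rewrite in_itv/= v0 -v1 (bigD1 x) ?inE//= lerDl.
  by rewrite sumr_ge0.
Qed.

Let chaining_sum_continuous (n : X -> R) : (forall x, 0 <= n x) ->
  continuous (chaining_sum n : T -> \bar R).
Proof.
move=> n0 v; have FF : ProperFilter (nbhs v) by exact: nbhs_pfilter.
have H0 (w : T) (A : {set X}) :
    (0 <= extend0 h (clamp (\sum_(y in A) w y)))%E.
  by apply: extend0_ge0 => //;
    rewrite /clamp ?ge_max ?le_max ?ge_min ?lexx ?ler01.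
have term0 (w : T) (x : X) (A : {set X}) :
    (0 <= (level_length x A)%:E * extend0 h (clamp (\sum_(y in A) w y)))%E.
  by rewrite mule_ge0// lee_fin level_length_ge0.
pose F (x : X) (A : {set X}) (w : T) : \bar R :=
  ((level_length x A)%:E * extend0 h (clamp (\sum_(y in A) w y)))%E.
have F_cvg (x : X) (A : {set X}) : F x A w @[w --> v] --> F x A v.
  apply: cvgeZl => //.
  apply: (@continuous_comp _ _ _ (fun v : T => \sum_(y in A) v y)
    (fun p => extend0 h (clamp p))); first exact: sum_continuous.
  exact: continuous_clamped.
pose G (x : X) (w : T) : \bar R := ((n x)%:E * \sum_(A : {set X}) F x A w)%E.
have G_cvg (x : X) : G x w @[w --> v] --> G x v.
  apply: cvgeZl => //.
  have := @cvg_nnesum T (nbhs v) _ R _ (index_enum {set X}) (F x)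
    (fun A => F x A v) xpredT.
  by apply => A _; [apply: nearW => w; exact: term0 | exact: F_cvg].
have := @cvg_nnesum T (nbhs v) _ R _ (index_enum X) G (fun x => G x v) xpredT.
apply => x _; last exact: G_cvg.
apply: nearW => w; rewrite /G mule_ge0 ?lee_fin// sume_ge0// => A _.
exact: term0.
Qed.

Theorem exists_minimizer (n : probability (discrete X) R) :
  exists m0 : probability (discrete X) R,
    forall m : probability (discrete X) R,
    (chaining_integral h m0 n <= chaining_integral h m n)%E.
Proof.
have sT (w : X -> R) : \sum_(x in [set: X]%SET) w x = \sum_x w x.
  by apply: eq_bigl => y; rewrite inE.
have in_simplex (m : probability (discrete X) R) : simplex (weight m).
  by split; [exact: weight_ge0|rewrite sT weight_sum1].
(* [contract] is an increasing continuous map of the extended reals into the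
   reals, so it reduces the claim to real-valued functions. *)
have [||v] := @compact_EVT_min T R
  (fun v : T => contract (chaining_sum (weight n) v)) simplex _ simplex_compact.
- by exists (weight n).
- apply: continuous_subspaceT => v.
  apply: (@continuous_comp _ _ _ (chaining_sum (weight n) : T -> \bar R)
    (@contract R)).
    by apply: chaining_sum_continuous; exact: weight_ge0.
  exact: contract_continuous.
rewrite inE => -[v0 v1] vmin; rewrite sT in v1.
have [m0 m0v] := probability_of_weights v0 v1.
exists m0 => m; rewrite !chaining_integral_sum m0v.
have := vmin (weight m); rewrite inE => /(_ (in_simplex m)).
by rewrite le_contract.
Qed.

End minimizer.

(** * Comparing a measure with any other *)

Section self_chaining.
Context {R : realType} {X : finMetricType R}.
Variable h : R -> R.
Hypothesis nh : normalized_functional h.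
Local Notation mu := (@lebesgue_measure R).
Local Notation mass m A := (\sum_(y in A) weight m y).

(** Apply [extend0_div_e] at each point [x] of positive weight, with [p] the
    [n]-mass of [fball x r] and [q] the [m]-mass of [fball x (r / 2)]; the error
    terms add up to at most [1 / e] by [sum_ball_ratio_le1]. *)
Lemma pointwise_self_chaining (m n : probability (discrete X) R) (r : R) :
  0 <= r ->
  (\sum_x (weight n x)%:E * extend0 h (mass n (fball x r)) <=
   \sum_x (weight n x)%:E * extend0 h (mass m (fball x (r / 2))) +
   (expR 1)^-1%:E)%E.
Proof.
move=> r0.
pose q x := mass m (fball x (r / 2)); pose p x := mass n (fball x r).
apply: (@le_trans _ _ (\sum_x ((weight n x)%:E * extend0 h (q x) +
    (weight n x * (q x / p x) * (expR 1)^-1)%:E))%E).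
  apply: lee_sum => x _.
  have := weight_ge0 n x; rewrite le_eqVlt => /predU1P[<-|nx].
    by rewrite !mul0e !mul0r adde0.
  have /andP[q0 q1] := weight_sum_itv m (fball x (r / 2)).
  have /andP[_ p1] := weight_sum_itv n (fball x r).
  have p0 : 0 < p x.
    apply: lt_le_trans nx _; rewrite /p (bigD1 x) ?fball_center//= lerDl.
    by rewrite sumr_ge0// => y _; exact: weight_ge0.
  apply: le_trans (lee_wpmul2l _ (extend0_div_e nh p0 p1 q0 q1)) _.
    by rewrite lee_fin ltW.
  rewrite ge0_muleDr ?extend0_ge0// -?EFinM ?mulrA// lee_fin.
  by rewrite !mulr_ge0// ?invr_ge0 ?expR_ge0// ltW.
rewrite big_split/= leeD2l// sumEFin lee_fin -mulr_suml.
rewrite ler_piMl ?invr_ge0 ?expR_ge0//.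
apply: sum_ball_ratio_le1;
  [exact: weight_ge0 | exact: weight_ge0 | exact: weight_sum1].
Qed.

Lemma self_chaining_diam (n : probability (discrete X) R) (r : R) :
  diam X <= r ->
  (\sum_x (weight n x)%:E * extend0 h (mass n (fball x r)) = 0)%E.
Proof.
move=> Dr; apply: big1 => x _.
by rewrite (fball_diam _ Dr) (extend0_weightT nh) mule0.
Qed.

Let integral_weighted (n : probability (discrete X) R) (G : X -> R -> \bar R) :
  (forall x r, (0 <= G x r)%E) ->
  (forall x, measurable_fun (`[0, +oo[%classic : set R) (G x)) ->
  (\int[mu]_(r in `[0%R, +oo[) (\sum_x (weight n x)%:E * G x r) =
   \sum_x (weight n x)%:E * \int[mu]_(r in `[0%R, +oo[) G x r)%E.
Proof.
move=> G0 mG; rewrite ge0_integral_sum//.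
- apply: eq_bigr => x _; apply: ge0_integralZl => //; first exact: mG.
  by rewrite lee_fin weight_ge0.
- by move=> x; apply: measurable_funeM; exact: mG.
- by move=> x r _; apply: mule_ge0 => //; rewrite lee_fin weight_ge0.
Qed.

(** Integrate the pointwise bound over the radii below the diameter; beyond it
    the left-hand side vanishes. *)
Theorem self_chaining_le (m n : probability (discrete X) R) :
  (chaining_integral h n n <=
   2%:E * chaining_integral h m n + (diam X / expR 1)%:E)%E.
Proof.
pose H (m : probability (discrete X) R) (A : {set X}) := extend0 h (mass m A).
have H0 m' A : (0 <= H m' A)%E by exact: extend0_weight_ge0.
have sum0 m' (s : R) :
    (0 <= \sum_x (weight n x)%:E * H m' (fball x s))%E.
  apply: sume_ge0 => x _; apply: mule_ge0; last exact: H0.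
  by rewrite lee_fin weight_ge0.
have mH m' x : measurable_fun (`[0, +oo[%classic : set R)
    (fun r : R => H m' (fball x r)) by exact: measurable_fball.
have mH2 x : measurable_fun (`[0, +oo[%classic : set R)
    (fun r : R => H m (fball x (r / 2))).
  apply: (@measurableT_comp _ _ _ _ _ _ (fun r : R => H m (fball x r))).
    exact: measurable_fball.
  exact: measurable_funM.
have E2 : (2%:E * chaining_integral h m n =
    \int[mu]_(r in `[0%R, +oo[)
      \sum_x (weight n x)%:E * H m (fball x (r / 2)))%E.
  rewrite integral_weighted// (chaining_integralE nh) ge0_sume_distrr => [|x _].
    apply: eq_bigr => x _; rewrite muleCA; congr (_ * _)%E.
    by rewrite (integral_fball_half x (H0 m)).
  by rewrite mule_ge0 ?lee_fin ?weight_ge0// integral_ge0// => r _; exact: H0.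
have mD : measurable_fun (`[0, +oo[%classic : set R)
    (fun r : R => ((expR 1)^-1 * (\1_(`[0, diam X[%classic : set R) r : R))%:E).
  suff : measurable_fun (`[0, +oo[%classic : set R)
    (fun r : R => (expR 1)^-1 * (\1_(`[0, diam X[%classic : set R) r : R)).
    by move/measurable_EFinP.
  apply: measurable_funM => //; exact: measurable_indic.
have ED : ((diam X / expR 1)%:E = \int[mu]_(r in `[0%R, +oo[)
    ((expR 1)^-1 * (\1_(`[0, diam X[%classic : set R) r : R))%:E)%E.
  under eq_integral do rewrite EFinM.
  rewrite ge0_integralZl; last 4 first.
  - exact: measurable_itv.
  - by apply/measurable_EFinP; exact: measurable_indic.
  - by move=> r _; rewrite lee_fin.
  - by rewrite lee_fin invr_ge0 expR_ge0.
  rewrite integral_indic// setIidl; last first.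
    by move=> r /=; rewrite !in_itv/= andbT => /andP[].
  by rewrite [X in (_ * X)%E](measure_itvco diam_ge0) subr0 -EFinM mulrC.
rewrite E2 ED -ge0_integralD; last 5 first.
- exact: measurable_itv.
- by move=> r _; exact: (sum0 m (r / 2)).
- by apply: emeasurable_sum => x; apply: measurable_funeM; exact: mH2.
- by move=> r _; rewrite lee_fin mulr_ge0// invr_ge0 expR_ge0.
- exact: mD.
rewrite (chaining_integralE nh).
rewrite -(integral_weighted n (fun x r => H0 n (fball x r)) (mH n)).
apply: ge0_le_integral => //.
- by apply: emeasurable_sum => x; apply: measurable_funeM; exact: mH.
- apply: emeasurable_funD; last exact: mD.
  by apply: emeasurable_sum => x; apply: measurable_funeM; exact: mH2.
- move=> r /=; rewrite in_itv/= andbT => r0.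
  have [Dr|rD] := leP (diam X) r.
    rewrite self_chaining_diam//; apply: adde_ge0.
      exact: (sum0 m (r / 2)).
    by rewrite lee_fin mulr_ge0// invr_ge0 expR_ge0.
  apply: le_trans (pointwise_self_chaining m n r0) _.
  rewrite leeD2l// lee_fin indicE mem_set ?mulr1//.
  by rewrite /= in_itv/= r0 rD.
Qed.

End self_chaining.

Theorem lemma1p4 (R : realType) (X : finMetricType R) (h : R -> R)
    (hlc : log_concave_chaining_functional h)
    (h1 : exists2 l : R, is_left_derivative h 1 l & `|l| = 1)
    (nu : probability (discrete X) R) :
  exists mu0 : probability (discrete X) R,
    (forall mu : probability (discrete X) R,
       (chaining_integral h mu0 nu <= chaining_integral h mu nu)%E) /\
    (chaining_integral h nu nu
       <= 2%:E * chaining_integral h mu0 nu + (diam X / expR 1)%:E)%E.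
Proof.
case: h1 => l dl l1.
have nh := normalized_of_log_concave hlc dl l1.
have [mu0 min0] := exists_minimizer nh nu.
by exists mu0; split => //; exact: self_chaining_le.
Qed.
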